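(* Suppose that $\sum_{n=0}^\infty a_n^{-1}<\infty$, that $a_n\to\infty$, $\beta_n\to\beta_\infty$ as $n\to\infty$ with $|\beta_\infty|<1$, and that $(k_n-1)\in\ell^1$ and $(\beta_n')\in\ell^1(\mathbb Z_+)$. Then for all $z\in\mathbb C$ the orthogonal polynomials $P_n(z)$ and the polynomials of the second kind $Q_n(z)$ have the asymptotics, as $n\to\infty$, $$P_n(z)=a_n^{-1/2}\big(\sigma_+(z)\Theta_n^{(+)}+\sigma_-(z)\Theta_n^{(-)}+o(1)\big)$$ and $$Q_n(z)=a_n^{-1/2}\big(\tau_+(z)\Theta_n^{(+)}+\tau_-(z)\Theta_n^{(-)}+o(1)\big).$$
   Context: $\mathbb Z_+=\{0,1,2,\dots\}$; $a_n>0$ and $b_n\in\mathbb R$ for $n\in\mathbb Z_+$, and $a_{-1}>0$ is an arbitrary fixed number. For a sequence $x_n$ put $x_n'=x_{n+1}-x_n$. Notation: $$\beta_n=-\frac{b_n}{2\sqrt{a_{n-1}a_n}},\quad k_n=\frac{a_n}{\sqrt{a_{n-1}a_{n+1}}}.$$ The Jacobi equation is $a_{n-1}u_{n-1}+b_nu_n+a_nu_{n+1}=zu_n$. The polynomials $P_n(z)$ satisfy it for $n\ge0$ with $P_{-1}(z)=0$, $P_0(z)=1$; the polynomials of the second kind $Q_n(z)$ satisfy it for $n\ge1$ with $Q_0(z)=0$, $Q_1(z)=a_0^{-1}$. Fix $N_0$ such that $|\beta_n|$ is separated from $1$ and $|\beta_n|<1$ for $n\ge N_0$, and put $\Theta_n^{(\pm)}=\exp\big(\mp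 i\sum_{m=N_0}^{n-1}\arccos\beta_m\big)$. Under the stated hypotheses, for every $z\in\mathbb C$ the Jacobi equation has unique, linearly independent solutions $f_n^{(\pm)}(z)$ with $f_n^{(\pm)}(z)=a_n^{-1/2}\Theta_n^{(\pm)}(1+o(1))$ as $n\to\infty$. The coefficients $\sigma_\pm(z)$, $\tau_\pm(z)$ are the (unique) numbers such that $$P_n(z)=\sigma_+(z)f_n^{(+)}(z)+\sigma_-(z)f_n^{(-)}(z),\qquad Q_n(z)=\tau_+(z)f_n^{(+)}(z)+\tau_-(z)f_n^{(-)}(z),\qquad n\ge0.$$ *)

(* Defs.v *)
From Stdlib Require Import Reals List.
From Coquelicot Require Import Coquelicot.

Open Scope R_scope.

(* A sequence (x_n) indexed by n = -1, 0, 1, ... is represented by its value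
   xm1 at -1 together with x : nat -> T, and prev xm1 x n is x_{n-1}. *)
Definition prev {T : Type} (xm1 : T) (x : nat -> T) (n : nat) : T :=
  match n with
  | O => xm1
  | S m => x m
  end.

Definition beta (am1 : R) (a b : nat -> R) (n : nat) : R :=
  - (b n / (2 * sqrt (prev am1 a n * a n))).

Definition kappa (am1 : R) (a : nat -> R) (n : nat) : R :=
  a n / sqrt (prev am1 a n * a (S n)).

Definition in_l1 (x : nat -> R) : Prop := ex_series (fun n => Rabs (x n)).

Definition Cexp (w : C) : C :=
  (exp (Re w) * cos (Im w), exp (Re w) * sin (Im w)).

(* The sum runs over N0 <= m <= n - 1; it is 0 when n <= N0. *)
Definition phase (am1 : R) (a b : nat -> R) (N0 n : nat) : R :=
  fold_right Rplus 0
    (map (fun m => acos (beta am1 a b m)) (seq N0 (n - N0))).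

Definition Theta_plus (am1 : R) (a b : nat -> R) (N0 n : nat) : C :=
  Cexp (- Ci * RtoC (phase am1 a b N0 n))%C.

Definition Theta_minus (am1 : R) (a b : nat -> R) (N0 n : nat) : C :=
  Cexp (Ci * RtoC (phase am1 a b N0 n))%C.

Definition little_o1 (r : nat -> C) : Prop :=
  filterlim r eventually (locally (RtoC 0)).

Definition jacobi_at (am1 : R) (a b : nat -> R) (z um1 : C) (u : nat -> C)
    (n : nat) : Prop :=
  (RtoC (prev am1 a n) * prev um1 u n + RtoC (b n) * u n
     + RtoC (a n) * u (S n) = z * u n)%C.

Definition first_kind (am1 : R) (a b : nat -> R) (P : nat -> C -> C) : Prop :=
  forall z : C,
    P 0%nat z = RtoC 1 /\
    forall n : nat, jacobi_at am1 a b z (RtoC 0) (fun m => P m z) n.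

(* For n >= 1 the equation involves neither a_{-1} nor u_{-1}. *)
Definition second_kind (a b : nat -> R) (Q : nat -> C -> C) : Prop :=
  forall z : C,
    Q 0%nat z = RtoC 0 /\
    Q 1%nat z = RtoC (/ a 0%nat) /\
    forall n : nat,
      (RtoC (a n) * Q n z + RtoC (b (S n)) * Q (S n) z
         + RtoC (a (S n)) * Q (S (S n)) z = z * Q (S n) z)%C.

(* (u_n) for n >= -1 solves the Jacobi equation for all n >= 0 and
   u_n = a_n^{-1/2} Theta_n (1 + o(1)). *)
Definition jost (am1 : R) (a b : nat -> R) (Theta : nat -> C) (z um1 : C)
    (u : nat -> C) : Prop :=
  (forall n : nat, jacobi_at am1 a b z um1 u n) /\
  exists r : nat -> C, little_o1 r /\
    forall n : nat,
      (u n = RtoC (/ sqrt (a n)) * Theta n * (RtoC 1 + r n))%C.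

Definition unique_jost (am1 : R) (a b : nat -> R) (Theta : nat -> C) (z um1 : C)
    (u : nat -> C) : Prop :=
  jost am1 a b Theta z um1 u /\
  forall (vm1 : C) (v : nat -> C), jost am1 a b Theta z vm1 v ->
    vm1 = um1 /\ forall n : nat, v n = u n.

Definition lin_indep (u v : nat -> C) : Prop :=
  forall c d : C,
    (forall n : nat, (c * u n + d * v n)%C = RtoC 0) ->
    c = RtoC 0 /\ d = RtoC 0.

Definition expansion (w u v : nat -> C) (c d : C) : Prop :=
  forall n : nat, w n = (c * u n + d * v n)%C.

Definition unique_expansion (w u v : nat -> C) (c d : C) : Prop :=
  expansion w u v c d /\
  forall c' d' : C, expansion w u v c' d' -> c' = c /\ d' = d.

(* w_n = a_n^{-1/2} (c Theta_n^(+) + d Theta_n^(-) + o(1)). *)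
Definition oscillating_asymptotics (a : nat -> R) (Thp Thm : nat -> C)
    (w : nat -> C) (c d : C) : Prop :=
  exists r : nat -> C, little_o1 r /\
    forall n : nat,
      w n = (RtoC (/ sqrt (a n)) * (c * Thp n + d * Thm n + r n))%C.

(* Main.v *)
(* With [v n = sqrt (a n) * w n], every solution [w] of the Jacobi equation for
   [n >= 1] satisfies [v (n+1) - 2 beta_n v n + v (n-1) = O(e n (|v n| + |v (n-1)|))]
   with [e] summable. Putting [zeta_n = e^{-i arccos beta_n}], the quantities
   [v (n+1) - conj zeta_n * v n] and [v (n+1) - zeta_n * v n] are multiplied at each
   step by [zeta_(n+1)] and its conjugate, up to summable errors, so
   [v = c Theta^(+) + d Theta^(-) + o(1)]. If [v -> 0], the Wronskian of [w] with any
   other solution is constant and tends to [0], hence [w = 0]: the linear map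
   [w |-> (c, d)] is injective, and so bijective, on the two-dimensional space of
   solutions. The Jost solutions are the preimages of [(1, 0)] and [(0, 1)], and the
   coefficients [sigma], [tau] are the values of this map at [P] and [Q]. *)
Require Import Defs.
From Stdlib Require Import Reals Lra Lia List.
From Coquelicot Require Import Coquelicot.

Open Scope R_scope.

(** * Real sequences with summable increments or summable growth rates *)

Lemma ex_lim_seq_of_summable_increments (u e : nat -> R) :
  ex_series e -> (forall n, Rabs (u (S n) - u n) <= e n) ->
  exists l : R, is_lim_seq u l.
Proof.
intros He Hu.
assert (Hs : ex_series (fun n => u (S n) - u n)).
{ apply (ex_series_le (fun n => u (S n) - u n) e); [exact Hu | exact He]. }
destruct Hs as [s Hs].
exists (s + u 0%nat).
apply is_lim_seq_incr_1.
apply is_lim_seq_ext with (fun n => sum_n (fun k => u (S k) - u k) n + u 0%nat).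
{ intros n; induction n as [|n IH].
  - rewrite sum_O; ring.
  - rewrite sum_Sn; unfold plus; simpl; simpl in IH; lra. }
apply is_lim_seq_plus'; [exact Hs | apply is_lim_seq_const].
Qed.

(** A discrete Gronwall inequality: [1 + e n <= exp (e n)], so the growth factors multiply to at
    most the exponential of the sum of the series. *)
Lemma bounded_of_summable_growth (x e : nat -> R) :
  (forall n, 0 <= x n) -> (forall n, 0 <= e n) -> ex_series e ->
  (forall n, x (S n) <= (1 + e n) * x n) ->
  exists M, forall n, x n <= M.
Proof.
intros Hx He [s Hs] Hstep.
assert (Hle : forall n, sum_n e n <= s).
{ intros n; apply (is_lim_seq_incr_compare (sum_n e)); [exact Hs|].
  intros m; rewrite sum_Sn; unfold plus; simpl; specialize (He (S m)); lra. }
assert (Hexp : forall n, x (S n) <= x 0%nat * exp (sum_n e n)).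
{ assert (Hone : forall n, 1 + e n <= exp (e n)) by (intros n; apply exp_ineq1_le).
  intros n; induction n as [|n IH].
  - rewrite sum_O. specialize (Hstep 0%nat); specialize (Hone 0%nat).
    specialize (Hx 0%nat); nra.
  - rewrite sum_Sn; unfold plus; simpl; rewrite exp_plus.
    specialize (Hstep (S n)); specialize (Hone (S n)); specialize (Hx (S n)).
    pose proof (exp_pos (e (S n))). nra. }
assert (Hs0 : 0 <= s).
{ specialize (Hle 0%nat); rewrite sum_O in Hle; specialize (He 0%nat); lra. }
exists (x 0%nat * exp s); intros [|n].
- pose proof (exp_ineq1_le s); specialize (Hx 0%nat); nra.
- apply Rle_trans with (1 := Hexp n).
  apply Rmult_le_compat_l; [apply Hx|].
  destruct (Hle n) as [H|H]; [left; apply exp_increasing, H | rewrite H; lra].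
Qed.

Lemma is_lim_seq_bounded (u : nat -> R) (l : R) :
  is_lim_seq u l -> exists M, 0 <= M /\ forall n, Rabs (u n) <= M.
Proof.
intros Hu.
destruct (filterlim_bounded u) as [M HM]; [exists l; exact Hu|].
exists M; split; [|exact HM].
apply Rle_trans with (2 := HM 0%nat), Rabs_pos.
Qed.

(** * Complex sequences tending to zero *)

(** Passing to moduli makes squeezing and algebra of limits available from real sequences;
    [little_o1_null_seq] gives the link with the filter formulation. *)
Definition null_seq (r : nat -> C) : Prop := is_lim_seq (fun n => Cmod (r n)) 0.

Lemma little_o1_null_seq (r : nat -> C) : little_o1 r <-> null_seq r.
Proof.
unfold little_o1, null_seq; split; intros H.
- apply is_lim_seq_spec; intros eps.
  (* Balls of [C] as a product space are squares, and a square of half-side [r] lies in the disc of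
     radius [sqrt 2 * r]; hence the division of [eps]. *)
  assert (Hd : 0 < eps / sqrt 2).
  { apply Rdiv_lt_0_compat; [apply cond_pos | apply Rlt_sqrt2_0]. }
  assert (Hb := H (fun z => ball (RtoC 0) (mkposreal _ Hd) z)).
  assert (Hl : eventually (fun n => ball (RtoC 0) (mkposreal _ Hd) (r n))).
  { apply Hb; exists (mkposreal _ Hd); auto. }
  revert Hl; apply filter_imp; intros n Hn.
  assert (Hc := C_NormedModule_mixin_compat2 _ _ _ Hn).
  simpl in Hc.
  replace (sqrt 2 * (eps / sqrt 2)) with (pos eps) in Hc
    by (field; apply Rgt_not_eq, Rlt_sqrt2_0).
  change (Cmod (r n - RtoC 0)%C < eps) in Hc.
  replace (r n - RtoC 0)%C with (r n) in Hc by ring.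
  rewrite Rminus_0_r, Rabs_pos_eq; [exact Hc | apply Cmod_ge_0].
- intros P [eps HP].
  apply is_lim_seq_spec in H; specialize (H eps).
  unfold filtermap; revert H; apply filter_imp; intros n Hn; apply HP.
  apply C_NormedModule_mixin_compat1.
  rewrite Rminus_0_r, Rabs_pos_eq in Hn by apply Cmod_ge_0.
  change (Cmod (r n - RtoC 0)%C < eps).
  replace (r n - RtoC 0)%C with (r n) by ring; exact Hn.
Qed.

Lemma null_seq_ext (u v : nat -> C) :
  (forall n, u n = v n) -> null_seq u -> null_seq v.
Proof. intros H; apply is_lim_seq_ext; intros n; now rewrite H. Qed.

Lemma null_seq_le (u : nat -> C) (e : nat -> R) :
  (forall n, Cmod (u n) <= e n) -> is_lim_seq e 0 -> null_seq u.
Proof.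
intros H He.
apply is_lim_seq_le_le with (fun _ => 0) e.
- intros n; split; [apply Cmod_ge_0 | apply H].
- apply is_lim_seq_const.
- exact He.
Qed.

Lemma null_seq_incr_1 (u : nat -> C) : null_seq u <-> null_seq (fun n => u (S n)).
Proof. apply (is_lim_seq_incr_1 (fun n => Cmod (u n))). Qed.

Lemma null_seq_incr_n (u : nat -> C) (N : nat) :
  null_seq u <-> null_seq (fun n => u (n + N)%nat).
Proof. apply (is_lim_seq_incr_n (fun n => Cmod (u n))). Qed.

Lemma null_seq_plus (u v : nat -> C) :
  null_seq u -> null_seq v -> null_seq (fun n => u n + v n)%C.
Proof.
intros Hu Hv.
apply null_seq_le with (fun n => Cmod (u n) + Cmod (v n)).
- intros n; apply Cmod_triangle.
- replace 0 with (0 + 0) by ring. now apply is_lim_seq_plus'.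
Qed.

Lemma null_seq_bounded_mult (u v : nat -> C) (M : R) :
  (forall n, Cmod (u n) <= M) -> null_seq v -> null_seq (fun n => u n * v n)%C.
Proof.
intros Hu Hv.
apply null_seq_le with (fun n => M * Cmod (v n)).
- intros n; rewrite Cmod_mult.
  apply Rmult_le_compat_r; [apply Cmod_ge_0 | apply Hu].
- replace 0 with (M * 0) by ring. now apply (is_lim_seq_scal_l _ M 0).
Qed.

Lemma null_seq_scal (c : C) (v : nat -> C) :
  null_seq v -> null_seq (fun n => c * v n)%C.
Proof. now apply (null_seq_bounded_mult (fun _ => c) v (Cmod c)); intros; right. Qed.

Lemma null_seq_opp (v : nat -> C) : null_seq v -> null_seq (fun n => - v n)%C.
Proof. apply is_lim_seq_ext; intros n; now rewrite Cmod_opp. Qed.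

Lemma null_seq_minus (u v : nat -> C) :
  null_seq u -> null_seq v -> null_seq (fun n => u n - v n)%C.
Proof. intros Hu Hv; apply null_seq_plus, null_seq_opp; assumption. Qed.

Lemma null_seq_RtoC (x : nat -> R) (l : R) :
  is_lim_seq x l -> null_seq (fun n => RtoC (x n) - RtoC l)%C.
Proof.
intros Hx. unfold null_seq.
apply is_lim_seq_ext with (fun n => Rabs (x n - l)).
- intros n. now rewrite <- RtoC_minus, Cmod_R.
- apply -> is_lim_seq_abs_0. replace 0 with (l - l) by ring.
  apply is_lim_seq_minus'; [exact Hx | apply is_lim_seq_const].
Qed.

Lemma null_seq_const_eq_0 (c : C) : null_seq (fun _ => c) -> c = RtoC 0.
Proof.
intros H. apply Cmod_eq_0.
assert (Hc : is_lim_seq (fun _ : nat => Cmod c) (Cmod c)) by apply is_lim_seq_const.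
apply is_lim_seq_unique in H. apply is_lim_seq_unique in Hc.
rewrite H in Hc. now injection Hc.
Qed.

Lemma Cmod_le_sum (x : C) : Cmod x <= Rabs (fst x) + Rabs (snd x).
Proof.
replace x with (RtoC (fst x) + Ci * RtoC (snd x))%C at 1.
- eapply Rle_trans; [apply Cmod_triangle|].
  rewrite Cmod_mult, Cmod_Ci, !Cmod_R; lra.
- destruct x as [p q]; unfold RtoC, Ci, Cplus, Cmult; simpl; f_equal; ring.
Qed.

Lemma Cmod_ge_components (x : C) : Rabs (fst x) <= Cmod x /\ Rabs (snd x) <= Cmod x.
Proof.
pose proof (Rmax_Cmod x).
pose proof (Rmax_l (Rabs (fst x)) (Rabs (snd x))).
pose proof (Rmax_r (Rabs (fst x)) (Rabs (snd x))). lra.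
Qed.

Lemma C_limit_of_summable_increments (u : nat -> C) (e : nat -> R) :
  ex_series e -> (forall n, Cmod (u (S n) - u n) <= e n) ->
  exists l : C, null_seq (fun n => u n - l)%C.
Proof.
intros He Hu.
destruct (ex_lim_seq_of_summable_increments (fun n => fst (u n)) e He) as [p Hp].
{ intros n. apply Rle_trans with (2 := Hu n).
  apply (Cmod_ge_components (u (S n) - u n)%C). }
destruct (ex_lim_seq_of_summable_increments (fun n => snd (u n)) e He) as [q Hq].
{ intros n. apply Rle_trans with (2 := Hu n).
  apply (Cmod_ge_components (u (S n) - u n)%C). }
exists (p, q).
apply null_seq_le with (fun n => Rabs (fst (u n) - p) + Rabs (snd (u n) - q)).
{ intros n; apply (Cmod_le_sum (u n - (p, q))%C). }
assert (Habs : forall (x : nat -> R) (l : R), is_lim_seq x l ->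
  is_lim_seq (fun n => Rabs (x n - l)) 0).
{ intros x l Hx. apply -> is_lim_seq_abs_0. replace 0 with (l - l) by ring.
  apply is_lim_seq_minus'; [exact Hx | apply is_lim_seq_const]. }
replace 0 with (0 + 0) by ring. apply is_lim_seq_plus'; now apply Habs.
Qed.

(** * The characteristic roots on the unit circle *)

(* [unit_root x] is [e^{-i arccos x}] for [|x| <= 1]. *)
Definition unit_root (x : R) : C := (x, - sqrt (1 - x * x)).

Lemma Cmod_unit_root (x : R) : Rabs x <= 1 -> Cmod (unit_root x) = 1.
Proof.
intros Hx. unfold Cmod, unit_root; simpl.
assert (Hs : 0 <= 1 - x * x) by (apply Rabs_le_between in Hx; nra).
replace (x * (x * 1) + _) with 1; [apply sqrt_1|].
pose proof (sqrt_sqrt _ Hs). nra.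
Qed.

Lemma unit_root_plus_conj (x : R) :
  (unit_root x + Cconj (unit_root x) = RtoC (2 * x))%C.
Proof. unfold unit_root, Cconj, Cplus, RtoC; simpl; f_equal; ring. Qed.

Lemma unit_root_mult_conj (x : R) :
  Rabs x <= 1 -> (unit_root x * Cconj (unit_root x) = RtoC 1)%C.
Proof.
intros Hx; rewrite <- Cmod2_conj, Cmod_unit_root by exact Hx.
f_equal; ring.
Qed.

(** Factor [1 - x * x = (1 - |x|) (1 + |x|)]: the first factor is at least [delta], the second at
    least [1]. *)
Lemma sqrt_1_minus_sqr_ge (x delta : R) :
  0 < delta -> Rabs x <= 1 - delta -> sqrt delta <= sqrt (1 - x * x).
Proof.
intros Hd Hx; apply sqrt_le_1_alt. apply Rabs_le_between in Hx.
destruct (Rle_or_lt 0 x); nra.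
Qed.

(** The derivative of [sqrt (1 - x * x)] blows up only at the endpoints, from which [delta] keeps
    [x] and [y] away. This turns summable variation of [beta] into summable variation of the
    roots. *)
Lemma unit_root_Lipschitz (x y delta : R) :
  0 < delta -> Rabs x <= 1 - delta -> Rabs y <= 1 - delta ->
  Cmod (unit_root x - unit_root y) <= (1 + / sqrt delta) * Rabs (x - y).
Proof.
intros Hd Hx Hy.
apply Rle_trans with (1 := Cmod_le_sum _); simpl.
change (fst (unit_root x - unit_root y)%C) with (x - y).
change (snd (unit_root x - unit_root y)%C)
  with (- sqrt (1 - x * x) - - sqrt (1 - y * y)).
pose proof (sqrt_1_minus_sqr_ge x delta Hd Hx) as Hsx.
pose proof (sqrt_1_minus_sqr_ge y delta Hd Hy) as Hsy.
pose proof (sqrt_lt_R0 _ Hd) as Hsd.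
apply Rabs_le_between in Hx as Hx'. apply Rabs_le_between in Hy as Hy'.
assert (Hqx := sqrt_sqrt (1 - x * x) ltac:(nra)).
assert (Hqy := sqrt_sqrt (1 - y * y) ltac:(nra)).
set (sx := sqrt (1 - x * x)) in *. set (sy := sqrt (1 - y * y)) in *.
set (sd := sqrt delta) in *.
(* The difference of the squares [sx * sx] and [sy * sy] is that of [y * y] and [x * x]. *)
assert (Hprod : Rabs (- sx - - sy) * (sx + sy) = Rabs (x - y) * Rabs (x + y)).
{ rewrite <- (Rabs_pos_eq (sx + sy)) by lra. rewrite <- !Rabs_mult.
  f_equal. nra. }
assert (Hsum : Rabs (x + y) <= 2) by (apply Rabs_le; lra).
assert (Hmain : Rabs (- sx - - sy) * sd <= Rabs (x - y)).
{ pose proof (Rabs_pos (- sx - - sy)). pose proof (Rabs_pos (x - y)).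
  assert (Rabs (- sx - - sy) * (2 * sd) <= Rabs (- sx - - sy) * (sx + sy))
    by (apply Rmult_le_compat_l; lra).
  assert (Rabs (x - y) * Rabs (x + y) <= Rabs (x - y) * 2)
    by (apply Rmult_le_compat_l; lra).
  lra. }
rewrite Rmult_plus_distr_r, Rmult_1_l.
apply Rplus_le_compat_l.
apply Rmult_le_reg_r with sd; [exact Hsd|].
replace (/ sd * Rabs (x - y) * sd) with (Rabs (x - y)) by (field; lra).
exact Hmain.
Qed.

(** * The perturbed oscillating recurrence *)

(** In the rotating frame [X n / Th (S n)] the increments have modulus at most [e n], so they sum to
    a limit [xi]. The index [S n] appears because the step from [X n] multiplies by [zeta (S n)], as
    does the step from [Th (S n)]. *)
Lemma rotating_limit (X Th zeta : nat -> C) (e : nat -> R) :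
  ex_series e -> (forall n, Cmod (Th n) = 1) ->
  (forall n, Th (S n) = (Th n * zeta n)%C) ->
  (forall n, Cmod (X (S n) - zeta (S n) * X n) <= e n) ->
  exists xi : C, null_seq (fun n => X n - xi * Th (S n))%C.
Proof.
intros He HTh Hrec HX.
assert (Hne : forall n, Th n <> RtoC 0).
{ intros n; apply Cmod_gt_0; rewrite HTh; lra. }
destruct (C_limit_of_summable_increments (fun n => X n / Th (S n))%C e He) as [xi Hxi].
{ intros n.
  replace (X (S n) / Th (S (S n)) - X n / Th (S n))%C
    with ((X (S n) - zeta (S n) * X n) / Th (S (S n)))%C.
  - rewrite Cmod_div, HTh, Rdiv_1_r by apply Hne. apply HX.
  - assert (Hz := Hne (S (S n))). rewrite (Hrec (S n)) in *.
    assert (Hz' : zeta (S n) <> RtoC 0).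
    { intros E; apply Hz; rewrite E; ring. }
    field. split; [apply Hne | exact Hz']. }
exists xi.
apply null_seq_ext with (fun n => Th (S n) * (X n / Th (S n) - xi))%C.
- intros n; field; apply Hne.
- apply null_seq_bounded_mult with 1; [|exact Hxi].
  intros n; rewrite HTh; lra.
Qed.

(* The quasi-factorisation of [v'' - (zeta + omega) v' + zeta omega v]: the error
   comes from the variation of [omega]. *)
Lemma factored_recurrence (v zeta omega : nat -> C) (e g : nat -> R) (n : nat) :
  (zeta (S n) * omega (S n) = RtoC 1)%C -> Cmod (zeta (S n)) = 1 ->
  Cmod (omega n - omega (S n)) <= g n ->
  Cmod (v (S (S n)) - (zeta (S n) + omega (S n)) * v (S n) + v n)
    <= e n * (Cmod (v n) + Cmod (v (S n))) ->
  Cmod ((v (S (S n)) - omega (S n) * v (S n)) - zeta (S n) * (v (S n) - omega n * v n))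
    <= (e n + g n) * (Cmod (v n) + Cmod (v (S n))).
Proof.
intros Hzo Hz Ho Hv.
replace ((v (S (S n)) - omega (S n) * v (S n)) - zeta (S n) * (v (S n) - omega n * v n))%C
  with ((v (S (S n)) - (zeta (S n) + omega (S n)) * v (S n) + v n)
        + zeta (S n) * (omega n - omega (S n)) * v n)%C.
2:{ transitivity ((v (S (S n)) - (zeta (S n) + omega (S n)) * v (S n) + v n)
        + zeta (S n) * omega n * v n - (zeta (S n) * omega (S n)) * v n)%C;
    [ring | rewrite Hzo; ring]. }
eapply Rle_trans; [apply Cmod_triangle|].
rewrite !Cmod_mult, Hz.
pose proof (Cmod_ge_0 (v n)). pose proof (Cmod_ge_0 (v (S n))).
pose proof (Cmod_ge_0 (omega n - omega (S n))).
nra.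
Qed.

(** The errors carry the unknown factor [|v n| + |v (S n)|], so the argument has two rounds:
    Gronwall first bounds [v], then the errors are summable outright and [rotating_limit] applies to
    both modes. Going back from the modes to [v] divides by the difference of the two roots, which
    [delta] keeps away from zero. *)
Lemma oscillating_recurrence (beta e : nat -> R) (beta_inf delta : R) (v Th : nat -> C) :
  0 < delta -> (forall n, Rabs (beta n) <= 1 - delta) ->
  is_lim_seq beta beta_inf -> Rabs beta_inf < 1 ->
  ex_series (fun n => Rabs (beta (S n) - beta n)) ->
  ex_series e -> (forall n, 0 <= e n) ->
  (forall n, Cmod (v (S (S n)) - RtoC (2 * beta (S n)) * v (S n) + v n)
    <= e n * (Cmod (v n) + Cmod (v (S n)))) ->
  (forall n, Cmod (Th n) = 1) ->
  (forall n, Th (S n) = (Th n * unit_root (beta n))%C) ->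
  exists c d : C, null_seq (fun n => v n - (c * Th n + d * Cconj (Th n)))%C.
Proof.
intros Hd Hb Hlim Hinf Hvar He Hepos Hv HTh Hrec.
set (zeta := fun n => unit_root (beta n)).
set (omega := fun n => Cconj (unit_root (beta n))).
set (s := fun n => sqrt (1 - beta n * beta n)).
set (sd := sqrt delta).
assert (Hsd : 0 < sd) by now apply sqrt_lt_R0.
assert (Hs : forall n, sd <= s n) by (intros n; now apply sqrt_1_minus_sqr_ge).
assert (Hb1 : forall n, Rabs (beta n) <= 1) by (intros n; specialize (Hb n); lra).
set (g := fun n => (1 + / sd) * Rabs (beta (S n) - beta n)).
assert (Hg : forall n, Cmod (zeta n - zeta (S n)) <= g n).
{ intros n; unfold g; rewrite (Rabs_minus_sym (beta (S n))).
  now apply unit_root_Lipschitz. }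
assert (Hg' : forall n, Cmod (omega n - omega (S n)) <= g n).
{ intros n; unfold omega; rewrite <- Cminus_conj, Cmod_conj; apply Hg. }
assert (Hgpos : forall n, 0 <= g n).
{ intros n; apply Rle_trans with (2 := Hg n), Cmod_ge_0. }
set (f := fun n => e n + g n).
assert (Hf : ex_series f).
{ apply (ex_series_plus e g He). exact (ex_series_scal_l (1 + / sd) _ Hvar). }
assert (Hfpos : forall n, 0 <= f n).
{ intros n; unfold f; specialize (Hepos n); specialize (Hgpos n); lra. }
(* [X] removes the mode driven by [omega] and [Y] the one driven by [zeta]; each then follows a
   first-order recurrence. *)
set (X := fun n => (v (S n) - omega n * v n)%C).
set (Y := fun n => (v (S n) - zeta n * v n)%C).
assert (Hz1 : forall n, Cmod (zeta n) = 1) by (intros n; now apply Cmod_unit_root).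
assert (Ho1 : forall n, Cmod (omega n) = 1).
{ intros n; unfold omega; rewrite Cmod_conj; apply Hz1. }
assert (HX : forall n, Cmod (X (S n) - zeta (S n) * X n)
                       <= f n * (Cmod (v n) + Cmod (v (S n)))).
{ intros n; apply (factored_recurrence v zeta omega e g); auto.
  - now apply unit_root_mult_conj.
  - unfold zeta, omega; rewrite unit_root_plus_conj; apply Hv. }
assert (HY : forall n, Cmod (Y (S n) - omega (S n) * Y n)
                       <= f n * (Cmod (v n) + Cmod (v (S n)))).
{ intros n; apply (factored_recurrence v omega zeta e g); auto.
  - rewrite Cmult_comm; now apply unit_root_mult_conj.
  - unfold zeta, omega; rewrite (Cplus_comm (Cconj _)), unit_root_plus_conj; apply Hv. }
(* Since [zeta n - omega n] is [- 2 i s n], this [h n] is its inverse, and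
   [X n - Y n = (zeta n - omega n) * v n] can be solved for [v n]. *)
set (h := fun n => (Ci * RtoC (/ (2 * s n)))%C).
assert (Hh : forall n, Cmod (h n) <= / (2 * sd)).
{ intros n; unfold h; rewrite Cmod_mult, Cmod_Ci, Cmod_R, Rmult_1_l.
  specialize (Hs n). rewrite Rabs_pos_eq.
  - apply Rinv_le_contravar; lra.
  - left; apply Rinv_0_lt_compat; lra. }
assert (Hhz : forall n, (h n * zeta n = RtoC (/ 2) + Ci * RtoC (/ 2 * (beta n / s n)))%C).
{ intros n; specialize (Hs n); unfold h, zeta, unit_root; fold (s n).
  unfold Ci, Cmult, Cplus, RtoC; simpl; f_equal; field; lra. }
assert (Hho : forall n, (h n * omega n = - RtoC (/ 2) + Ci * RtoC (/ 2 * (beta n / s n)))%C).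
{ intros n; specialize (Hs n); unfold h, omega, unit_root; fold (s n).
  unfold Ci, Cmult, Cplus, Copp, Cconj, RtoC; simpl; f_equal; field; lra. }
assert (Hvh : forall n, v n = (h n * (X n - Y n))%C).
{ intros n; unfold X, Y.
  transitivity (((h n * zeta n) - (h n * omega n)) * v n)%C; [|ring].
  rewrite Hhz, Hho.
  replace (RtoC (/ 2) + Ci * RtoC (/ 2 * (beta n / s n)) -
    (- RtoC (/ 2) + Ci * RtoC (/ 2 * (beta n / s n))))%C with (RtoC (/ 2 + / 2))
    by (rewrite RtoC_plus; ring).
  replace (/ 2 + / 2) with 1 by field. ring. }
(* The quantity for Gronwall: [T] controls [v n] through [h], and [v (S n)] through [X n]. *)
set (T := fun n => Cmod (X n) + Cmod (Y n)).
set (K := 1 + / sd).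
assert (Hisd : 0 < / sd) by now apply Rinv_0_lt_compat.
assert (HvT : forall n, Cmod (v n) + Cmod (v (S n)) <= K * T n).
{ intros n.
  assert (H1 : Cmod (v n) <= / 2 * / sd * T n).
  { rewrite Hvh, Cmod_mult. rewrite <- Rinv_mult.
    apply Rmult_le_compat; [apply Cmod_ge_0 | apply Cmod_ge_0 | apply Hh |].
    unfold Cminus; eapply Rle_trans; [apply Cmod_triangle|].
    rewrite Cmod_opp; right; reflexivity. }
  assert (H2 : Cmod (v (S n)) <= Cmod (X n) + Cmod (v n)).
  { replace (v (S n)) with (X n + omega n * v n)%C by (unfold X; ring).
    eapply Rle_trans; [apply Cmod_triangle|].
    rewrite Cmod_mult, Ho1; lra. }
  assert (Cmod (X n) <= T n) by (unfold T; pose proof (Cmod_ge_0 (Y n)); lra).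
  unfold K; lra. }
assert (HTbound : exists M, forall n, T n <= M).
{ apply bounded_of_summable_growth with (fun n => 2 * K * f n).
  - intros n; unfold T; pose proof (Cmod_ge_0 (X n)); pose proof (Cmod_ge_0 (Y n)); lra.
  - intros n; apply Rmult_le_pos; [unfold K; lra | apply Hfpos].
  - exact (ex_series_scal_l (2 * K) _ Hf).
  (* Rotation preserves moduli, so [X] and [Y] each gain at most [f n * (K * T n)]; together this
     gives the rate [2 * K * f n]. *)
  - intros n.
    assert (HfT : f n * (Cmod (v n) + Cmod (v (S n))) <= f n * (K * T n))
      by (apply Rmult_le_compat_l; auto).
    assert (Cmod (X (S n)) <= Cmod (X n) + f n * (K * T n)).
    { replace (X (S n)) with (zeta (S n) * X n + (X (S n) - zeta (S n) * X n))%C by ring.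
      eapply Rle_trans; [apply Cmod_triangle|].
      rewrite Cmod_mult, Hz1. specialize (HX n). lra. }
    assert (Cmod (Y (S n)) <= Cmod (Y n) + f n * (K * T n)).
    { replace (Y (S n)) with (omega (S n) * Y n + (Y (S n) - omega (S n) * Y n))%C by ring.
      eapply Rle_trans; [apply Cmod_triangle|].
      rewrite Cmod_mult, Ho1. specialize (HY n). lra. }
    unfold T at 1; replace ((1 + 2 * K * f n) * T n)
      with (T n + 2 * (f n * (K * T n))) by ring.
    unfold T at 1; lra. }
destruct HTbound as [M HM].
assert (HfM : forall n, f n * (Cmod (v n) + Cmod (v (S n))) <= K * M * f n).
{ intros n; rewrite (Rmult_comm _ (f n)); apply Rmult_le_compat_l; auto.
  eapply Rle_trans; [apply HvT|].
  apply Rmult_le_compat_l; [unfold K; lra | apply HM]. }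
assert (HfMs : ex_series (fun n => K * M * f n))
  by exact (ex_series_scal_l (K * M) _ Hf).
destruct (rotating_limit X Th zeta _ HfMs HTh Hrec) as [xi Hxi].
{ intros n; eapply Rle_trans; [apply HX | apply HfM]. }
destruct (rotating_limit Y (fun n => Cconj (Th n)) omega _ HfMs) as [eta Heta].
{ intros n; now rewrite Cmod_conj. }
{ intros n; now rewrite Hrec, Cmult_conj. }
{ intros n; eapply Rle_trans; [apply HY | apply HfM]. }
(* Convergence of [beta] makes [h n * zeta n] and [h n * omega n] tend to [1/2 + i q/2] and
   [- 1/2 + i q/2]. *)
set (q := beta_inf / sqrt (1 - beta_inf * beta_inf)).
assert (Hq : is_lim_seq (fun n => beta n / s n) q).
{ apply is_lim_seq_div'; [exact Hlim | |].
  - apply (is_lim_seq_continuous sqrt (fun n => 1 - beta n * beta n)).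
    + apply continuity_pt_sqrt. apply Rabs_def2 in Hinf; nra.
    + apply is_lim_seq_minus'; [apply is_lim_seq_const|].
      now apply is_lim_seq_mult'.
  - apply Rgt_not_eq, sqrt_lt_R0. apply Rabs_def2 in Hinf; nra. }
apply null_seq_RtoC in Hq.
(* In [v = h (X - Y)], replace [X n] by [xi * Th n * zeta n] and [Y n] by its conjugate analogue.
   The coefficients are [xi] times the limit of [h zeta] and minus [eta] times the limit of
   [h omega]. *)
exists (xi * (RtoC (/ 2) + Ci * RtoC (/ 2) * RtoC q))%C,
  (eta * (RtoC (/ 2) - Ci * RtoC (/ 2) * RtoC q))%C.
apply null_seq_ext with (fun n =>
  h n * ((X n - xi * Th (S n)) - (Y n - eta * Cconj (Th (S n))))
  + (xi * Ci * RtoC (/ 2)) * (Th n * (RtoC (beta n / s n) - RtoC q))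
  - (eta * Ci * RtoC (/ 2)) * (Cconj (Th n) * (RtoC (beta n / s n) - RtoC q)))%C.
{ intros n. rewrite Hrec, Cmult_conj. change (Cconj (unit_root (beta n))) with (omega n); fold (zeta n).
  transitivity (h n * (X n - Y n) - xi * Th n * (h n * zeta n)
    + eta * Cconj (Th n) * (h n * omega n)
    + (xi * Ci * RtoC (/ 2)) * (Th n * (RtoC (beta n / s n) - RtoC q))
    - (eta * Ci * RtoC (/ 2)) * (Cconj (Th n) * (RtoC (beta n / s n) - RtoC q)))%C;
    [ring|].
  rewrite <- Hvh, Hhz, Hho, (RtoC_mult (/ 2)). ring. }
apply null_seq_minus; [apply null_seq_plus|].
- apply null_seq_bounded_mult with (1 := Hh). now apply null_seq_minus.
- apply null_seq_scal, null_seq_bounded_mult with 1; [|exact Hq].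
  intros n; rewrite HTh; lra.
- apply null_seq_scal, null_seq_bounded_mult with 1; [|exact Hq].
  intros n; rewrite Cmod_conj, HTh; lra.
Qed.

(** * The phase and the oscillating factors *)

Lemma phase_S (am1 : R) (a b : nat -> R) (N0 n : nat) :
  (N0 <= n)%nat ->
  phase am1 a b N0 (S n) = phase am1 a b N0 n + acos (beta am1 a b n).
Proof.
intros Hn; unfold phase.
rewrite Nat.sub_succ_l, seq_S, map_app, fold_right_app by exact Hn.
replace (N0 + (n - N0))%nat with n by lia. simpl; rewrite Rplus_0_r.
generalize (acos (beta am1 a b n)) as t; intros t.
induction (map _ _) as [|y l IH]; simpl; [ring | rewrite IH; ring].
Qed.

Lemma Theta_plus_polar (am1 : R) (a b : nat -> R) (N0 n : nat) :
  Theta_plus am1 a b N0 n = (cos (phase am1 a b N0 n), - sin (phase am1 a b N0 n)).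
Proof.
unfold Theta_plus, Cexp; simpl.
set (t := phase am1 a b N0 n).
replace (- (0) * t - - (1) * 0) with 0 by ring.
replace (- (0) * 0 + - (1) * t) with (- t) by ring.
rewrite exp_0, cos_neg, sin_neg; f_equal; ring.
Qed.

Lemma Theta_minus_conj (am1 : R) (a b : nat -> R) (N0 n : nat) :
  Theta_minus am1 a b N0 n = Cconj (Theta_plus am1 a b N0 n).
Proof.
rewrite Theta_plus_polar; unfold Theta_minus, Cexp, Cconj; simpl.
set (t := phase am1 a b N0 n).
replace (0 * t - 1 * 0) with 0 by ring.
replace (0 * 0 + 1 * t) with t by ring.
rewrite exp_0; f_equal; ring.
Qed.

Lemma Cmod_Theta_plus (am1 : R) (a b : nat -> R) (N0 n : nat) :
  Cmod (Theta_plus am1 a b N0 n) = 1.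
Proof.
rewrite Theta_plus_polar; unfold Cmod; simpl.
set (t := phase am1 a b N0 n). pose proof (sin2_cos2 t) as H; unfold Rsqr in H.
replace (_ + _) with 1; [apply sqrt_1 | lra].
Qed.

(** The addition formulas with [sin (acos x) = sqrt (1 - x^2)]. The restriction [N0 <= n] matters:
    below [N0] the phase stays at [0]. *)
Lemma Theta_plus_S (am1 : R) (a b : nat -> R) (N0 n : nat) :
  (N0 <= n)%nat -> Rabs (beta am1 a b n) <= 1 ->
  Theta_plus am1 a b N0 (S n)
    = (Theta_plus am1 a b N0 n * unit_root (beta am1 a b n))%C.
Proof.
intros Hn Hb; apply Rabs_le_between in Hb.
rewrite !Theta_plus_polar, phase_S by exact Hn.
rewrite cos_plus, sin_plus, cos_acos, sin_acos by exact Hb.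
unfold unit_root, Cmult, Rsqr; simpl; f_equal; ring.
Qed.

(** * The two-dimensional solution space and the Wronskian *)

(** Only the equations at indices from [1] on are kept. They do not see the value at [-1], so [P],
    [Q] and the Jost solutions all live in one space, parametrised by the values at [0] and [1]. *)
Definition solution (a b : nat -> R) (z : C) (w : nat -> C) : Prop :=
  forall n : nat,
    (RtoC (a n) * w n + RtoC (b (S n)) * w (S n)
       + RtoC (a (S n)) * w (S (S n)) = z * w (S n))%C.

Lemma solution_lin_comb (a b : nat -> R) (z c d : C) (u v : nat -> C) :
  solution a b z u -> solution a b z v ->
  solution a b z (fun n => c * u n + d * v n)%C.
Proof.
intros Hu Hv n.
replace (z * (c * u (S n) + d * v (S n)))%C
  with (c * (z * u (S n)) + d * (z * v (S n)))%C by ring.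
rewrite <- (Hu n), <- (Hv n); ring.
Qed.

Lemma solution_exists (a b : nat -> R) (z x y : C) :
  (forall n, 0 < a n) ->
  exists w, solution a b z w /\ w 0%nat = x /\ w 1%nat = y.
Proof.
intros Ha.
(* Iterating on pairs [(w n, w (S n))] turns the second-order recursion into a first-order one. *)
set (step := fun n (p : C * C) => (snd p,
  ((z * snd p - RtoC (b (S n)) * snd p - RtoC (a n) * fst p) / RtoC (a (S n)))%C)).
set (pair := nat_rect (fun _ => (C * C)%type) (x, y) step).
exists (fun n => fst (pair n)); split; [|split; reflexivity].
intros n; simpl.
assert (Hne : RtoC (a (S n)) <> RtoC 0).
{ intros E; injection E; specialize (Ha (S n)); lra. }
field; exact Hne.
Qed.

Lemma solution_eq_0 (a b : nat -> R) (z : C) (w : nat -> C) :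
  (forall n, 0 < a n) -> solution a b z w ->
  w 0%nat = RtoC 0 -> w 1%nat = RtoC 0 -> forall n, w n = RtoC 0.
Proof.
intros Ha Hw H0 H1.
assert (H : forall n, w n = RtoC 0 /\ w (S n) = RtoC 0).
{ induction n as [|n [IH0 IH1]]; [now split|]; split; [exact IH1|].
  assert (Hne : RtoC (a (S n)) <> RtoC 0).
  { intros E; injection E; specialize (Ha (S n)); lra. }
  specialize (Hw n); rewrite IH0, IH1 in Hw.
  replace (w (S (S n))) with (RtoC (a (S n)) * w (S (S n)) / RtoC (a (S n)))%C
    by (field; exact Hne).
  replace (RtoC (a (S n)) * w (S (S n)))%C with (RtoC 0); [field; exact Hne|].
  transitivity (z * RtoC 0)%C; [ring | rewrite <- Hw; ring]. }
intros n; apply H.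
Qed.

(** Multiply the equation of [u] by [v (S n)], that of [v] by [u (S n)], and subtract: the terms in
    [z] and [b] cancel. *)
Lemma wronskian_const (a b : nat -> R) (z : C) (u v : nat -> C) :
  solution a b z u -> solution a b z v -> forall n,
  (RtoC (a n) * (u n * v (S n) - u (S n) * v n)
    = RtoC (a 0%nat) * (u 0%nat * v 1%nat - u 1%nat * v 0%nat))%C.
Proof.
intros Hu Hv; induction n as [|n IH]; [reflexivity|].
rewrite <- IH.
assert (E := f_equal2 Cminus
  (f_equal (fun t => t * v (S n))%C (Hu n)) (f_equal (fun t => t * u (S n))%C (Hv n))).
simpl in E.
replace (z * u (S n) * v (S n) - z * v (S n) * u (S n))%C with (RtoC 0) in E by ring.
transitivity (RtoC (a (S n)) * (u (S n) * v (S (S n)) - u (S (S n)) * v (S n)) + RtoC 0)%C;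
  [ring | rewrite <- E; ring].
Qed.

(** * Rescaling by [sqrt (a n)] *)

Lemma kappa_S_sqrt (am1 : R) (a : nat -> R) (n : nat) :
  (forall n, 0 < a n) ->
  kappa am1 a (S n) = sqrt (a (S n)) * sqrt (a (S n)) / (sqrt (a n) * sqrt (a (S (S n)))).
Proof.
intros Ha. assert (Ha' : forall n, 0 <= a n) by (intros m; left; apply Ha).
unfold kappa; simpl. rewrite sqrt_mult, sqrt_sqrt by apply Ha'. reflexivity.
Qed.

(* [sqrt (a n / a (n+1))] is, up to a constant factor, the product of the [kappa]'s. *)
Lemma sqrt_ratio_bounded (am1 : R) (a : nat -> R) :
  (forall n, 0 < a n) -> in_l1 (fun n => kappa am1 a n - 1) ->
  exists M, forall n, sqrt (a n) / sqrt (a (S n)) <= M.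
Proof.
intros Ha Hk.
assert (Hs : forall n, 0 < sqrt (a n)) by (intros n; apply sqrt_lt_R0, Ha).
assert (Hpos : forall n, 0 < sqrt (a n) / sqrt (a (S n))).
{ intros n; now apply Rdiv_lt_0_compat. }
apply bounded_of_summable_growth with (fun n => Rabs (kappa am1 a (S n) - 1)).
- intros n; left; apply Hpos.
- intros n; apply Rabs_pos.
- now apply (ex_series_incr_1 (fun n => Rabs (kappa am1 a n - 1))).
- intros n.
  replace (sqrt (a (S n)) / sqrt (a (S (S n))))
    with (kappa am1 a (S n) * (sqrt (a n) / sqrt (a (S n)))).
  + apply Rmult_le_compat_r; [left; apply Hpos|].
    pose proof (Rle_abs (kappa am1 a (S n) - 1)); lra.
  + rewrite kappa_S_sqrt by exact Ha.
    pose proof (Hs n); pose proof (Hs (S n)); pose proof (Hs (S (S n))).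
    field; lra.
Qed.

(** Dividing the equation at [S n] by [sqrt (a n)] leaves [kappa] on [v (S (S n))] alone. Spreading
    it over all three terms isolates the model recurrence, at the cost of the term with
    [1 - kappa]. *)
Lemma scaled_recurrence (am1 : R) (a b : nat -> R) (z : C) (w : nat -> C) (n : nat) :
  (forall n, 0 < a n) -> solution a b z w ->
  let v := fun n => (RtoC (sqrt (a n)) * w n)%C in
  (RtoC (kappa am1 a (S n))
     * (v (S (S n)) - RtoC (2 * beta am1 a b (S n)) * v (S n) + v n)
   = z * RtoC (/ (sqrt (a n) * sqrt (a (S n)))) * v (S n)
     + RtoC (1 - kappa am1 a (S n))
       * (RtoC (2 * beta am1 a b (S n)) * v (S n) - v n))%C.
Proof.
intros Ha Hw v.
assert (Ha' : forall n, 0 <= a n) by (intros m; left; apply Ha).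
assert (Hs : forall n, 0 < sqrt (a n)) by (intros m; apply sqrt_lt_R0, Ha).
assert (Hb : 2 * beta am1 a b (S n) = - b (S n) / (sqrt (a n) * sqrt (a (S n)))).
{ unfold beta; simpl. rewrite sqrt_mult by apply Ha'.
  pose proof (Hs n); pose proof (Hs (S n)). field; lra. }
assert (E := Hw n).
rewrite Hb, kappa_S_sqrt by exact Ha.
rewrite <- (sqrt_sqrt (a n)), <- (sqrt_sqrt (a (S n))) in E by apply Ha'.
unfold v.
pose proof (Hs n) as H0; pose proof (Hs (S n)) as H1; pose proof (Hs (S (S n))) as H2.
set (p := sqrt (a n)) in *; set (q := sqrt (a (S n))) in *;
  set (r := sqrt (a (S (S n)))) in *.
assert (Hne : forall t, 0 < t -> RtoC t <> RtoC 0).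
{ intros t Ht E'; injection E'; lra. }
assert (Hpq : p * q <> 0) by nra. assert (Hpr : p * r <> 0) by nra.
rewrite RtoC_minus, RtoC_inv, !RtoC_div, RtoC_opp, !RtoC_mult by assumption.
rewrite !RtoC_mult in E.
apply Hne in H0; apply Hne in H1; apply Hne in H2.
set (x := w (S (S n))) in *.
assert (Ex : x = ((z * w (S n) - RtoC (b (S n)) * w (S n) - RtoC p * RtoC p * w n)
                   / (RtoC q * RtoC q))%C).
{ rewrite <- E. field; auto. }
rewrite Ex. field; auto.
Qed.

Lemma ex_series_shift (e : nat -> R) (N : nat) :
  ex_series e -> ex_series (fun n => e (n + N)%nat).
Proof.
intros H. apply (ex_series_incr_n e N) in H.
revert H; apply ex_series_ext; intros n; f_equal; lia.
Qed.

(** * Asymptotics of an arbitrary solution *)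

(** The graph of the map from [w] to [(c, d)]; working with the relation allows linearity to be used
    without choosing values. *)
Definition null_remainder (am1 : R) (a b : nat -> R) (N0 : nat) (w : nat -> C) (c d : C)
    : Prop :=
  null_seq (fun n => RtoC (sqrt (a n)) * w n
    - (c * Theta_plus am1 a b N0 n + d * Theta_minus am1 a b N0 n))%C.

Lemma solution_asymptotics (am1 : R) (a b : nat -> R) (beta_inf delta : R) (N0 : nat)
    (z : C) (w : nat -> C) :
  (forall n, 0 < a n) -> ex_series (fun n => / a n) ->
  is_lim_seq (beta am1 a b) beta_inf -> Rabs beta_inf < 1 ->
  in_l1 (fun n => kappa am1 a n - 1) ->
  in_l1 (fun n => beta am1 a b (S n) - beta am1 a b n) ->
  0 < delta -> (forall n, (N0 <= n)%nat -> Rabs (beta am1 a b n) <= 1 - delta) ->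
  solution a b z w ->
  exists c d : C, null_remainder am1 a b N0 w c d.
Proof.
intros Ha Hser Hlim Hinf Hk Hvar Hd Hb Hw.
assert (Hs : forall n, 0 < sqrt (a n)) by (intros n; apply sqrt_lt_R0, Ha).
assert (Hkpos : forall n, 0 < kappa am1 a (S n)).
{ intros n; rewrite kappa_S_sqrt by exact Ha.
  pose proof (Hs n); pose proof (Hs (S n)); pose proof (Hs (S (S n))).
  apply Rdiv_lt_0_compat; nra. }
(* Summability of [kappa - 1] forces [kappa] to tend to [1], so dividing by it costs only a
   constant. *)
assert (Hkinv : exists M, 0 <= M /\ forall n, Rabs (/ kappa am1 a (S n)) <= M).
{ apply is_lim_seq_bounded with (/ 1).
  apply (is_lim_seq_inv (fun n => kappa am1 a (S n)) 1);
    [|intros E; injection E; lra].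
  apply (is_lim_seq_incr_1 (kappa am1 a)).
  apply is_lim_seq_ext with (fun n => (kappa am1 a n - 1) + 1); [intros n; ring|].
  replace (Finite 1) with (Finite (0 + 1)) by (f_equal; ring).
  apply is_lim_seq_plus'; [|apply is_lim_seq_const].
  apply ex_series_lim_0, ex_series_Rabs, Hk. }
destruct Hkinv as [M [HM HkM]].
(* [M] pays for the division by [kappa], the sum of inverses bounds [1 / sqrt (a n * a (S n))], and
   the [2] comes from [|2 beta| <= 2]. *)
set (e0 := fun n => M * (Cmod z * (/ a n + / a (S n))
                         + 2 * Rabs (kappa am1 a (S n) - 1))).
assert (He0 : ex_series e0).
{ apply (ex_series_scal_l M (fun n => Cmod z * (/ a n + / a (S n))
                         + 2 * Rabs (kappa am1 a (S n) - 1))).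
  apply (ex_series_plus (fun n => Cmod z * (/ a n + / a (S n)))
           (fun n => 2 * Rabs (kappa am1 a (S n) - 1))).
  - apply (ex_series_scal_l (Cmod z) (fun n => / a n + / a (S n))).
    apply (ex_series_plus (fun n => / a n) (fun n => / a (S n)) Hser).
    now apply (ex_series_incr_1 (fun n => / a n)).
  - apply (ex_series_scal_l 2 (fun n => Rabs (kappa am1 a (S n) - 1))).
    now apply (ex_series_incr_1 (fun n => Rabs (kappa am1 a n - 1))). }
assert (Hainv : forall n, 0 < / a n) by (intros n; apply Rinv_0_lt_compat, Ha).
set (v := fun n => (RtoC (sqrt (a n)) * w n)%C).
assert (Hv : forall n, (N0 <= n)%nat ->
  Cmod (v (S (S n)) - RtoC (2 * beta am1 a b (S n)) * v (S n) + v n)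
    <= e0 n * (Cmod (v n) + Cmod (v (S n)))).
{ intros n Hn.
  assert (E := scaled_recurrence am1 a b z w n Ha Hw); fold v in E; simpl in E.
  assert (Hbn : Rabs (beta am1 a b (S n)) <= 1).
  { specialize (Hb (S n) ltac:(lia)); lra. }
  set (D := (v (S (S n)) - RtoC (2 * beta am1 a b (S n)) * v (S n) + v n)%C) in *.
  (* The inequality of arithmetic and geometric means for the two inverses, without the factor
     [1/2]. *)
  assert (Hw1 : Cmod (RtoC (/ (sqrt (a n) * sqrt (a (S n))))) <= / a n + / a (S n)).
  { rewrite Cmod_R.
    specialize (Hs n) as H0; specialize (Hs (S n)) as H1.
    rewrite Rabs_pos_eq by (left; apply Rinv_0_lt_compat; nra).
    rewrite <- (sqrt_sqrt (a n)) at 2 by (left; apply Ha).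
    rewrite <- (sqrt_sqrt (a (S n))) at 2 by (left; apply Ha).
    rewrite !Rinv_mult.
    pose proof (Rinv_0_lt_compat _ H0); pose proof (Rinv_0_lt_compat _ H1).
    pose proof (Rle_0_sqr (/ sqrt (a n) - / sqrt (a (S n)))) as Hsq; unfold Rsqr in Hsq.
    nra. }
  assert (Hw2 : Cmod (RtoC (2 * beta am1 a b (S n)) * v (S n) - v n)
                <= 2 * (Cmod (v n) + Cmod (v (S n)))).
  { unfold Cminus; eapply Rle_trans; [apply Cmod_triangle|].
    rewrite Cmod_opp, Cmod_mult, Cmod_R, Rabs_mult, (Rabs_pos_eq 2) by lra.
    pose proof (Cmod_ge_0 (v n)); pose proof (Cmod_ge_0 (v (S n))); nra. }
  assert (HkD : Cmod (RtoC (kappa am1 a (S n)) * D)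
    <= (Cmod z * (/ a n + / a (S n)) + 2 * Rabs (kappa am1 a (S n) - 1))
       * (Cmod (v n) + Cmod (v (S n)))).
  { rewrite E; eapply Rle_trans; [apply Cmod_triangle|].
    rewrite !Cmod_mult, (Cmod_R (1 - _)), (Rabs_minus_sym 1), Rmult_plus_distr_r.
    apply Rplus_le_compat.
    - apply Rmult_le_compat; [|apply Cmod_ge_0 | |].
      + apply Rmult_le_pos; apply Cmod_ge_0.
      + apply Rmult_le_compat_l; [apply Cmod_ge_0 | exact Hw1].
      + pose proof (Cmod_ge_0 (v n)); lra.
    - rewrite (Rmult_comm 2 (Rabs _)), Rmult_assoc.
      apply Rmult_le_compat_l; [apply Rabs_pos | exact Hw2]. }
  specialize (Hkpos n); specialize (HkM n).
  replace D with (RtoC (/ kappa am1 a (S n)) * (RtoC (kappa am1 a (S n)) * D))%C.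
  2:{ rewrite RtoC_inv by lra. field. intros E'; injection E'; lra. }
  rewrite Cmod_mult, Cmod_R. unfold e0; rewrite Rmult_assoc.
  apply Rmult_le_compat; [apply Rabs_pos | apply Cmod_ge_0 | exact HkM | exact HkD]. }
assert (Hbn : forall n, (N0 <= n)%nat -> Rabs (beta am1 a b n) <= 1).
{ intros n Hn; specialize (Hb n Hn); lra. }
(* Everything is shifted by [N0], from where on [beta] stays in the allowed range and [Theta_plus]
   rotates; the conclusion concerns only the tail. *)
destruct (oscillating_recurrence (fun n => beta am1 a b (n + N0)) (fun n => e0 (n + N0)%nat)
  beta_inf delta (fun n => v (n + N0)%nat) (fun n => Theta_plus am1 a b N0 (n + N0)))
  as [c [d Hcd]]; auto.
- intros n; apply Hb; lia.
- now apply (is_lim_seq_incr_n (beta am1 a b)).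
- now apply (ex_series_shift (fun n => Rabs (beta am1 a b (S n) - beta am1 a b n))).
- now apply ex_series_shift.
- intros n; unfold e0. apply Rmult_le_pos; [exact HM|].
  pose proof (Rabs_pos (kappa am1 a (S (n + N0)) - 1)).
  pose proof (Hainv (n + N0)%nat); pose proof (Hainv (S (n + N0))).
  pose proof (Cmod_ge_0 z). nra.
- intros n; apply (Hv (n + N0)%nat); lia.
- intros n; apply Cmod_Theta_plus.
- intros n; apply (Theta_plus_S am1 a b N0 (n + N0)); [lia | apply Hbn; lia].
- exists c, d. apply (null_seq_incr_n _ N0).
  revert Hcd; apply null_seq_ext; intros n; now rewrite Theta_minus_conj.
Qed.

Lemma null_remainder_lin_comb (am1 : R) (a b : nat -> R) (N0 : nat) (u v : nat -> C)
    (s t c d c' d' : C) :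
  null_remainder am1 a b N0 u c d -> null_remainder am1 a b N0 v c' d' ->
  null_remainder am1 a b N0 (fun n => s * u n + t * v n)%C
    (s * c + t * c')%C (s * d + t * d')%C.
Proof.
intros Hu Hv. unfold null_remainder in *.
eapply null_seq_ext;
  [|exact (null_seq_plus _ _ (null_seq_scal s _ Hu) (null_seq_scal t _ Hv))].
intros n; simpl; ring.
Qed.

Lemma null_remainder_bounded (am1 : R) (a b : nat -> R) (N0 : nat) (w : nat -> C) (c d : C) :
  null_remainder am1 a b N0 w c d ->
  exists B, forall n, Cmod (RtoC (sqrt (a n)) * w n) <= B.
Proof.
intros H. destruct (is_lim_seq_bounded _ _ H) as [B [_ HB]].
exists (B + (Cmod c + Cmod d)); intros n; specialize (HB n).
rewrite Rabs_pos_eq in HB by apply Cmod_ge_0.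
set (y := (RtoC (sqrt (a n)) * w n)%C) in *.
set (x := (c * Theta_plus am1 a b N0 n + d * Theta_minus am1 a b N0 n)%C) in *.
replace y with ((y - x) + x)%C by ring.
eapply Rle_trans; [apply Cmod_triangle|]. apply Rplus_le_compat; [exact HB|].
unfold x; eapply Rle_trans; [apply Cmod_triangle|].
rewrite !Cmod_mult, Theta_minus_conj, Cmod_conj, Cmod_Theta_plus; lra.
Qed.

(** * Decaying solutions vanish; Jost solutions and expansions *)

(** In rescaled terms the Wronskian carries the factor [sqrt (a n) / sqrt (a (S n))]. The bound [M]
    on this ratio is what lets a null sequence times a bounded one force the constant to be zero. *)
Lemma solution_eq_0_of_null (a b : nat -> R) (z : C) (M : R) (w : nat -> C) :
  (forall n, 0 < a n) -> (forall n, sqrt (a n) / sqrt (a (S n)) <= M) ->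
  (forall s, solution a b z s ->
     exists B, forall n, Cmod (RtoC (sqrt (a n)) * s n) <= B) ->
  solution a b z w -> null_seq (fun n => RtoC (sqrt (a n)) * w n)%C ->
  forall n, w n = RtoC 0.
Proof.
intros Ha HM Hbd Hw Hnull.
assert (Hs : forall n, 0 < sqrt (a n)) by (intros n; apply sqrt_lt_R0, Ha).
assert (Hne : forall t, 0 < t -> RtoC t <> RtoC 0).
{ intros t Ht E; injection E; lra. }
assert (HW : forall s, solution a b z s ->
  (w 0%nat * s 1%nat - w 1%nat * s 0%nat)%C = RtoC 0).
{ intros s Hsol. destruct (Hbd s Hsol) as [B HB].
  set (V := fun n => (RtoC (sqrt (a n)) * w n)%C) in *.
  set (S' := fun n => (RtoC (sqrt (a n)) * s n)%C) in *.
  assert (Hc : (RtoC (a 0%nat) * (w 0%nat * s 1%nat - w 1%nat * s 0%nat))%C = RtoC 0).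
  { apply null_seq_const_eq_0.
    apply null_seq_ext with (fun n =>
      RtoC (sqrt (a n) / sqrt (a (S n))) * (S' (S n) * V n - S' n * V (S n)))%C.
    { intros n. rewrite <- (wronskian_const a b z w s Hw Hsol n).
      unfold V, S'. pose proof (Hs n) as H0; pose proof (Hs (S n)) as H1.
      replace (RtoC (a n)) with (RtoC (sqrt (a n)) * RtoC (sqrt (a n)))%C
        by (rewrite <- RtoC_mult, sqrt_sqrt by (left; apply Ha); reflexivity).
      rewrite RtoC_div by lra.
      field; auto. }
    apply null_seq_bounded_mult with M.
    - intros n; rewrite Cmod_R, Rabs_pos_eq; [apply HM|].
      left; now apply Rdiv_lt_0_compat.
    - apply null_seq_minus; apply null_seq_bounded_mult with B.
      + intros n; apply HB.
      + exact Hnull.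
      + exact HB.
      + now apply null_seq_incr_1 in Hnull. }
  replace (w 0%nat * s 1%nat - w 1%nat * s 0%nat)%C
    with (RtoC (a 0%nat) * (w 0%nat * s 1%nat - w 1%nat * s 0%nat) / RtoC (a 0%nat))%C
    by (field; auto).
  rewrite Hc; field; auto. }
(* Wronskians with the solutions starting [(1, 0)] and [(0, 1)] are [- w 1] and [w 0]. *)
destruct (solution_exists a b z (RtoC 1) (RtoC 0) Ha) as [s1 [Hs1 [E10 E11]]].
destruct (solution_exists a b z (RtoC 0) (RtoC 1) Ha) as [s2 [Hs2 [E20 E21]]].
assert (H1 := HW s1 Hs1). assert (H2 := HW s2 Hs2).
rewrite E10, E11 in H1. rewrite E20, E21 in H2.
apply (solution_eq_0 a b z); auto.
- rewrite <- H2; ring.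
- replace (w 1%nat) with (- (w 0%nat * RtoC 0 - w 1%nat * RtoC 1))%C by ring.
  rewrite H1; ring.
Qed.

(** As [Th] has modulus [1], the relative error [1 + o(1)] and an additive error are
    interchangeable. The equation at [0], the only one with the value at [-1], is split off. *)
Lemma jost_iff (am1 : R) (a b : nat -> R) (Th : nat -> C) (z um1 : C) (u : nat -> C) :
  (forall n, 0 < a n) -> (forall n, Cmod (Th n) = 1) ->
  jost am1 a b Th z um1 u <->
  jacobi_at am1 a b z um1 u 0 /\ solution a b z u /\
  null_seq (fun n => RtoC (sqrt (a n)) * u n - Th n)%C.
Proof.
intros Ha HTh.
assert (Hs : forall n, RtoC (sqrt (a n)) <> RtoC 0).
{ intros n E; injection E; pose proof (sqrt_lt_R0 _ (Ha n)); lra. }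
assert (Hs' : forall n, sqrt (a n) <> 0).
{ intros n; pose proof (sqrt_lt_R0 _ (Ha n)); lra. }
assert (HT : forall n, Th n <> RtoC 0).
{ intros n; apply Cmod_gt_0; rewrite HTh; lra. }
split.
- intros [Hj [r [Hr Hu]]]; split; [apply Hj | split].
  + intros n; exact (Hj (S n)).
  + apply null_seq_ext with (fun n => Th n * r n)%C.
    * intros n; rewrite Hu, RtoC_inv by apply Hs'; field; apply Hs.
    * apply null_seq_bounded_mult with 1; [intros n; rewrite HTh; lra|].
      now apply little_o1_null_seq.
- intros [H0 [Hsol Hnull]]; split; [intros [|n]; [exact H0 | exact (Hsol n)]|].
  exists (fun n => / Th n * (RtoC (sqrt (a n)) * u n - Th n))%C; split.
  + apply little_o1_null_seq. apply null_seq_bounded_mult with 1; [|exact Hnull].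
    intros n; rewrite Cmod_inv, HTh by apply HT; lra.
  + intros n; rewrite RtoC_inv by apply Hs'; field; split; [apply HT | apply Hs].
Qed.

(** Two candidates differ by a null solution, hence agree from [0] on; the equation at [0] then
    fixes the value at [-1], because [am1] is nonzero. *)
Lemma unique_jost_of_null (am1 : R) (a b : nat -> R) (Th : nat -> C) (z : C) (u : nat -> C) :
  0 < am1 -> (forall n, 0 < a n) -> (forall n, Cmod (Th n) = 1) ->
  (forall w, solution a b z w -> null_seq (fun n => RtoC (sqrt (a n)) * w n)%C ->
     forall n, w n = RtoC 0) ->
  solution a b z u -> null_seq (fun n => RtoC (sqrt (a n)) * u n - Th n)%C ->
  exists um1, unique_jost am1 a b Th z um1 u.
Proof.
intros Ham1 Ha HTh Hzero Hsol Hnull.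
assert (Hne : RtoC am1 <> RtoC 0) by (intros E; injection E; lra).
set (um1 := ((z * u 0%nat - RtoC (b 0%nat) * u 0%nat - RtoC (a 0%nat) * u 1%nat)
             / RtoC am1)%C).
exists um1; split.
- apply jost_iff; auto. split; [|now split].
  unfold jacobi_at, um1; simpl; field; exact Hne.
- intros vm1 v Hv. apply jost_iff in Hv; auto. destruct Hv as [Hv0 [Hvsol Hvnull]].
  assert (Hvu : forall n, v n = u n).
  { assert (Hd := Hzero (fun n => RtoC 1 * v n + (- RtoC 1) * u n)%C
      (solution_lin_comb a b z _ _ v u Hvsol Hsol)).
    intros n; replace (v n) with ((RtoC 1 * v n + (- RtoC 1) * u n) + u n)%C by ring.
    rewrite Hd; [ring|].
    eapply null_seq_ext; [|exact (null_seq_minus _ _ Hvnull Hnull)].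
    intros m; simpl; ring. }
  split; [|exact Hvu].
  unfold jacobi_at in Hv0; simpl in Hv0; rewrite !Hvu in Hv0.
  unfold um1; rewrite <- Hv0; field; exact Hne.
Qed.

(** The solution [w - c fp - d fm] has coefficients [(0, 0)], so it is null and vanishes; linear
    independence gives uniqueness. *)
Lemma unique_expansion_of_null_remainder (am1 : R) (a b : nat -> R) (N0 : nat) (z : C)
    (fp fm w : nat -> C) (c d : C) :
  (forall w, solution a b z w -> null_seq (fun n => RtoC (sqrt (a n)) * w n)%C ->
     forall n, w n = RtoC 0) ->
  solution a b z fp -> solution a b z fm -> solution a b z w ->
  null_remainder am1 a b N0 fp (RtoC 1) (RtoC 0) ->
  null_remainder am1 a b N0 fm (RtoC 0) (RtoC 1) ->
  null_remainder am1 a b N0 w c d -> lin_indep fp fm ->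
  unique_expansion w fp fm c d.
Proof.
intros Hzero Hp Hm Hw Np Nm Nw Hli.
assert (Hexp : expansion w fp fm c d).
{ intros n.
  assert (Hcs := solution_lin_comb a b z c d fp fm Hp Hm).
  assert (Hcn := null_remainder_lin_comb am1 a b N0 fp fm c d _ _ _ _ Np Nm).
  assert (Hd := Hzero _ (solution_lin_comb a b z (RtoC 1) (- RtoC 1)%C w _ Hw Hcs)).
  simpl in Hd.
  transitivity ((RtoC 1 * w n + - RtoC 1 * (c * fp n + d * fm n))
                + (c * fp n + d * fm n))%C; [ring|].
  rewrite Hd; [ring|].
  eapply null_seq_ext;
    [|exact (null_remainder_lin_comb am1 a b N0 _ _ (RtoC 1) (- RtoC 1)%C _ _ _ _ Nw Hcn)].
  intros m; simpl; ring. }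
split; [exact Hexp|].
intros c' d' H'.
destruct (Hli (c' - c)%C (d' - d)%C) as [E1 E2].
- intros n. transitivity ((c' * fp n + d' * fm n) - (c * fp n + d * fm n))%C; [ring|].
  rewrite <- (H' n), <- (Hexp n); ring.
- split.
  + replace c' with ((c' - c) + c)%C by ring; rewrite E1; ring.
  + replace d' with ((d' - d) + d)%C by ring; rewrite E2; ring.
Qed.

Lemma oscillating_asymptotics_of_null_remainder (am1 : R) (a b : nat -> R) (N0 : nat)
    (w : nat -> C) (c d : C) :
  (forall n, 0 < a n) -> null_remainder am1 a b N0 w c d ->
  oscillating_asymptotics a (Theta_plus am1 a b N0) (Theta_minus am1 a b N0) w c d.
Proof.
intros Ha H.
eexists; split; [apply little_o1_null_seq, H|].
intros n; simpl. pose proof (sqrt_lt_R0 _ (Ha n)).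
rewrite RtoC_inv by lra. field. intros E; injection E; lra.
Qed.

(** * Inverting the coefficient map and assembling the result *)

Theorem theorem7p3 :
  forall (am1 : R) (a b : nat -> R) (beta_inf : R) (N0 : nat)
    (P Q : nat -> C -> C),
    0 < am1 ->
    (forall n : nat, 0 < a n) ->
    ex_series (fun n => / a n) ->
    is_lim_seq a p_infty ->
    is_lim_seq (beta am1 a b) beta_inf ->
    Rabs beta_inf < 1 ->
    in_l1 (fun n => kappa am1 a n - 1) ->
    in_l1 (fun n => beta am1 a b (S n) - beta am1 a b n) ->
    (exists delta : R, 0 < delta /\
       forall n : nat, (N0 <= n)%nat -> Rabs (beta am1 a b n) <= 1 - delta) ->
    first_kind am1 a b P ->
    second_kind a b Q ->
    forall z : C,
      let Thp := Theta_plus am1 a b N0 in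
      let Thm := Theta_minus am1 a b N0 in
      exists (fpm1 : C) (fp : nat -> C) (fmm1 : C) (fm : nat -> C)
        (sigma_p sigma_m tau_p tau_m : C),
        unique_jost am1 a b Thp z fpm1 fp /\
        unique_jost am1 a b Thm z fmm1 fm /\
        lin_indep fp fm /\
        unique_expansion (fun n => P n z) fp fm sigma_p sigma_m /\
        unique_expansion (fun n => Q n z) fp fm tau_p tau_m /\
        oscillating_asymptotics a Thp Thm (fun n => P n z) sigma_p sigma_m /\
        oscillating_asymptotics a Thp Thm (fun n => Q n z) tau_p tau_m.
Proof.
intros am1 a b beta_inf N0 P Q Ham1 Ha Hser _ Hlim Hinf Hk Hvar [delta [Hd Hb]]
  HP HQ z Thp Thm.
assert (Hasym : forall w, solution a b z w -> exists c d, null_remainder am1 a b N0 w c d).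
{ intros w; eapply solution_asymptotics; eassumption. }
destruct (sqrt_ratio_bounded am1 a Ha Hk) as [M HM].
assert (Hzero : forall w, solution a b z w ->
  null_seq (fun n => RtoC (sqrt (a n)) * w n)%C -> forall n, w n = RtoC 0).
{ intros w; apply (solution_eq_0_of_null a b z M); auto.
  intros s Hs; destruct (Hasym s Hs) as [c [d Hcd]].
  exact (null_remainder_bounded am1 a b N0 s c d Hcd). }
assert (Hzero' : forall w, solution a b z w ->
  null_remainder am1 a b N0 w (RtoC 0) (RtoC 0) -> forall n, w n = RtoC 0).
{ intros w Hw Hn; apply Hzero; [exact Hw|].
  revert Hn; apply null_seq_ext; intros n; ring. }
destruct (solution_exists a b z (RtoC 1) (RtoC 0) Ha) as [s1 [Hs1 [E10 E11]]].
destruct (solution_exists a b z (RtoC 0) (RtoC 1) Ha) as [s2 [Hs2 [E20 E21]]].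
destruct (Hasym s1 Hs1) as [c1 [d1 N1]]. destruct (Hasym s2 Hs2) as [c2 [d2 N2]].
(* If the determinant vanished, [(c2, - c1)] and [(d2, - d1)] would lie in the kernel of the
   coefficient map. Its injectivity makes all four entries zero, and then [(1, 0)] lies in the
   kernel too. *)
assert (Hdet : (c1 * d2 - c2 * d1)%C <> RtoC 0).
{ intros Hdet.
  assert (Hcomb : forall s t : C, (s * c1 + t * c2)%C = RtoC 0 ->
    (s * d1 + t * d2)%C = RtoC 0 -> s = RtoC 0 /\ t = RtoC 0).
  { intros s t Ec Ed.
    assert (H := null_remainder_lin_comb am1 a b N0 s1 s2 s t _ _ _ _ N1 N2).
    rewrite Ec, Ed in H.
    assert (Hv := Hzero' _ (solution_lin_comb a b z s t s1 s2 Hs1 Hs2) H).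
    assert (Hv0 := Hv 0%nat). assert (Hv1 := Hv 1%nat).
    cbv beta in Hv0, Hv1. rewrite E10, E20 in Hv0. rewrite E11, E21 in Hv1.
    split; [rewrite <- Hv0 | rewrite <- Hv1]; ring. }
  destruct (Hcomb c2 (- c1)%C) as [Ec2 Ec1]; [ring | |].
  { transitivity (- (c1 * d2 - c2 * d1))%C; [ring | rewrite Hdet; ring]. }
  destruct (Hcomb d2 (- d1)%C) as [Ed2 Ed1]; [| ring |].
  { transitivity (c1 * d2 - c2 * d1)%C; [ring | exact Hdet]. }
  assert (Ec : c1 = RtoC 0) by (transitivity (- - c1)%C; [ring | rewrite Ec1; ring]).
  assert (Ed : d1 = RtoC 0) by (transitivity (- - d1)%C; [ring | rewrite Ed1; ring]).
  destruct (Hcomb (RtoC 1) (RtoC 0)) as [E _].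
  - rewrite Ec; ring.
  - rewrite Ed; ring.
  - injection E; lra. }
set (det := (c1 * d2 - c2 * d1)%C) in *.
(* Cramer's rule: the weights are the rows of the inverse matrix, so the coefficients become
   [(1, 0)] and [(0, 1)]. *)
set (fp := fun n => (d2 / det * s1 n + - d1 / det * s2 n)%C).
set (fm := fun n => (- c2 / det * s1 n + c1 / det * s2 n)%C).
assert (Hp : solution a b z fp) by now apply solution_lin_comb.
assert (Hm : solution a b z fm) by now apply solution_lin_comb.
assert (Np : null_remainder am1 a b N0 fp (RtoC 1) (RtoC 0)).
{ replace (RtoC 1) with (d2 / det * c1 + - d1 / det * c2)%C
    by (unfold det in *; field; exact Hdet).
  replace (RtoC 0) with (d2 / det * d1 + - d1 / det * d2)%C by (field; exact Hdet).
  now apply null_remainder_lin_comb. }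
assert (Nm : null_remainder am1 a b N0 fm (RtoC 0) (RtoC 1)).
{ replace (RtoC 1) with (- c2 / det * d1 + c1 / det * d2)%C
    by (unfold det in *; field; exact Hdet).
  replace (RtoC 0) with (- c2 / det * c1 + c1 / det * c2)%C by (field; exact Hdet).
  now apply null_remainder_lin_comb. }
assert (Hli : lin_indep fp fm).
{ intros c d H. assert (H0 := H 0%nat). assert (H1 := H 1%nat).
  unfold fp, fm in H0, H1. rewrite E10, E20 in H0. rewrite E11, E21 in H1.
  split.
  (* Applying the original matrix to the values at [0] and [1] undoes the inverse and recovers [c];
     likewise for [d] below. *)
  - transitivity (c1 * (c * (d2 / det * RtoC 1 + - d1 / det * RtoC 0)
        + d * (- c2 / det * RtoC 1 + c1 / det * RtoC 0))
      + c2 * (c * (d2 / det * RtoC 0 + - d1 / det * RtoC 1)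
        + d * (- c2 / det * RtoC 0 + c1 / det * RtoC 1)))%C;
      [unfold det in *; field; exact Hdet | rewrite H0, H1; ring].
  - transitivity (d1 * (c * (d2 / det * RtoC 1 + - d1 / det * RtoC 0)
        + d * (- c2 / det * RtoC 1 + c1 / det * RtoC 0))
      + d2 * (c * (d2 / det * RtoC 0 + - d1 / det * RtoC 1)
        + d * (- c2 / det * RtoC 0 + c1 / det * RtoC 1)))%C;
      [unfold det in *; field; exact Hdet | rewrite H0, H1; ring]. }
assert (HPs : solution a b z (fun n => P n z)).
{ intros n; exact (proj2 (HP z) (S n)). }
assert (HQs : solution a b z (fun n => Q n z)).
{ intros n; exact (proj2 (proj2 (HQ z)) n). }
destruct (unique_jost_of_null am1 a b Thp z fp) as [fpm1 Hjp]; auto.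
{ intros n; apply Cmod_Theta_plus. }
{ revert Np; apply null_seq_ext; intros n; unfold Thp; ring. }
destruct (unique_jost_of_null am1 a b Thm z fm) as [fmm1 Hjm]; auto.
{ intros n; unfold Thm; rewrite Theta_minus_conj, Cmod_conj; apply Cmod_Theta_plus. }
{ revert Nm; apply null_seq_ext; intros n; unfold Thm; ring. }
(* The coefficients from the asymptotics also serve as expansion coefficients in [fp] and [fm]. *)
destruct (Hasym _ HPs) as [sp [sm NP]]. destruct (Hasym _ HQs) as [tp [tm NQ]].
exists fpm1, fp, fmm1, fm, sp, sm, tp, tm.
split; [exact Hjp|]. split; [exact Hjm|]. split; [exact Hli|].
split; [|split; [|split]].
- now apply (unique_expansion_of_null_remainder am1 a b N0 z).
- now apply (unique_expansion_of_null_remainder am1 a b N0 z).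
- now apply oscillating_asymptotics_of_null_remainder.
- now apply oscillating_asymptotics_of_null_remainder.
Qed.
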